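(* Let $G$ be a connected graph with $n$ vertices and let $t\ge1$ be an integer. Then \[ \tau_t(G)\ge tn-\sum_{\{u,v\}}\big(d(u,v)-1\big), \] where the sum is over all unordered pairs of distinct vertices $u,v\in V(G)$. Furthermore, if $G$ has diameter $D$ and $t\ge (n-1)(D-1)$, then equality holds.
   Context: $d(u,v)$ is graph distance in $G$. A $t$-tone coloring of $G$ assigns to each vertex $v$ a set $f(v)$ of exactly $t$ colors from a color set $C$ such that $|f(u)\cap f(v)|<d(u,v)$ for all distinct $u,v$; $\tau_t(G)$ is the minimum $|C|$ over all such colorings. *)

(* Defs.v *)
From mathcomp Require Import all_boot all_order all_algebra.
Set Implicit Arguments.
Unset Strict Implicit.
Unset Printing Implicit Defensive.

(* A finite simple graph is a symmetric irreflexive relation e on a finType. *)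

Definition walk (T : finType) (e : rel T) (k : nat) (u v : T) : bool :=
  [exists p : k.-tuple T, path e u p && (last u p == v)].

(* A shortest walk has fewer than #|T| edges, so searching below #|T| suffices;
   #|T| itself is the junk value returned when v is not reachable from u. *)
Definition dist (T : finType) (e : rel T) (u v : T) : nat :=
  find (fun k => walk e k u v) (iota 0 #|T|).

Definition diameter (T : finType) (e : rel T) : nat :=
  \max_(u : T) \max_(v : T) dist e u v.

Definition connected_graph (T : finType) (e : rel T) : Prop :=
  forall u v : T, connect e u v.

Definition tone_coloring (T : finType) (e : rel T) (t : nat) (C : finType)
    (f : {ffun T -> {set C}}) : bool :=
  [forall v, #|f v| == t] &&
  [forall u, forall v, (u != v) ==> (#|f u :&: f v| < dist e u v)].

Definition tone_colorable (T : finType) (e : rel T) (t k : nat) : bool :=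
  [exists f : {ffun T -> {set 'I_k}}, tone_coloring e t f].

Lemma dist_gt0 (T : finType) (e : rel T) (u v : T) :
  u != v -> 0 < dist e u v.
Proof.
move=> uv; rewrite /dist.
have : 0 < #|T| by apply/card_gt0P; exists u.
case: #|T| => // n _ /=; case: ifP => // /existsP[p].
by rewrite (tuple0 p) /= (negbTE uv).
Qed.

Lemma tone_colorable_ex (T : finType) (e : rel T) (t : nat) :
  exists k, tone_colorable e t k.
Proof.
pose C : finType := (T * 'I_t)%type; exists #|C|; apply/existsP.
exists [ffun v => [set enum_rank ((v, i) : C) | i : 'I_t]].
apply/andP; split.
  apply/forallP => v; rewrite ffunE card_imset ?card_ord //.
  by move=> i j /enum_rank_inj[].
apply/forallP => u; apply/forallP => v; apply/implyP => uv.
rewrite !ffunE; set I := _ :&: _; suff -> : I = set0.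
  by rewrite cards0; exact: dist_gt0.
apply/setP => x; rewrite !inE; apply/andP => -[/imsetP[i _ ->] /imsetP[j _]].
by move=> /enum_rank_inj[E _]; rewrite E eqxx in uv.
Qed.

Definition tone_number (T : finType) (e : rel T) (t : nat) : nat :=
  ex_minn (tone_colorable_ex e t).

(* The sum of F over unordered pairs of distinct elements (F symmetric): each
   pair {u, v} is listed once, in the order of the enumeration of T. *)
Definition sum_pairs (T : finType) (F : T -> T -> int) : int :=
  (\sum_(p : T * T | (enum_rank p.1 < enum_rank p.2)%N) F p.1 p.2)%R.

(* Main.v *)
Require Import Defs.
From mathcomp Require Import all_boot all_order all_algebra.
From mathcomp Require Import zify.
Import Order.TTheory GRing.Theory Num.Theory.
Local Open Scope ring_scope.

Set Implicit Arguments.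
Unset Strict Implicit.

(** Lower bound: a color used on m vertices is counted m times in the sum of the
    |f(v)|, and m <= 1 + m(m-1)/2, so tn <= |C| + the sum of |f(u) & f(v)| over
    unordered pairs, where |f(u) & f(v)| <= d(u,v) - 1.

    Equality: give each pair {u,v} a block of d(u,v) - 1 colors shared by exactly
    u and v, and complete each f(v) with colors used at v only. This is possible
    once t is at least the sum of d(u,v) - 1 over u <> v, which is at most
    (n-1)(D-1). *)

Lemma walk_sym (T : finType) (e : rel T) (k : nat) (u v : T) :
  symmetric e -> walk e k u v = walk e k v u.
Proof.
move=> e_sym; suff walk_rev x y : walk e k x y -> walk e k y x
  by apply/idP/idP; apply: walk_rev.
case/existsP=> p /andP[xp /eqP lp]; apply/existsP.
(* Reversing [x :: p] puts its last vertex in front, as the new start; [rev (belast x p)] is what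
   follows it. *)
have sz : size (rev (belast x p)) == k by rewrite size_rev size_belast size_tuple.
exists (Tuple sz) => /=; rewrite -lp rev_path (@eq_path _ _ e) ?xp; last first.
  by move=> a b; rewrite /= e_sym.
by case: (tval p) => [|a s] //=; rewrite rev_cons last_rcons.
Qed.

Lemma dist_sym (T : finType) (e : rel T) (u v : T) :
  symmetric e -> dist e u v = dist e v u.
Proof. by move=> e_sym; apply: eq_find => k; apply: walk_sym. Qed.

Lemma dist_le_diameter (T : finType) (e : rel T) (u v : T) :
  (dist e u v <= diameter e)%N.
Proof.
exact: leq_trans (leq_bigmax v) (leq_bigmax (F := fun x => \max_y dist e x y)%N u).
Qed.

Section Pairs.
Variable T : finType.
Implicit Types (u v : T) (p : T * T).

(** The test that indexes [sum_pairs]: it keeps one of the two orders of each pair of distinct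
    elements. *)
Definition rank_lt p : bool := (enum_rank p.1 < enum_rank p.2)%N.

Lemma rank_lt_neq p : rank_lt p -> p.1 != p.2.
Proof. by apply: contraTneq => eq_p; rewrite /rank_lt eq_p ltnn. Qed.

Lemma rank_ltN u v : u != v -> rank_lt (v, u) = ~~ rank_lt (u, v).
Proof.
move=> uv; rewrite /rank_lt /= -leqNgt ltn_neqAle.
by rewrite (inj_eq val_inj) (inj_eq enum_rank_inj) eq_sym uv.
Qed.

(** Pairing the element of least rank with each other element of [A] already yields [#|A| - 1] such
    pairs. *)
Lemma card_le_pairs (A : {set T}) :
  (#|A| <= 1 + #|[set p | [&& p.1 \in A, p.2 \in A & rank_lt p]]|)%N.
Proof.
have [->|[x0 x0A]] := set_0Vmem A; first by rewrite cards0.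
case: (@arg_minnP T x0 (mem A) (fun x => enum_rank x : nat) x0A) => x.
rewrite -[mem A x]/(x \in A) => xA x_min.
have pair_inj : injective (pair x : T -> T * T) by move=> y z [].
rewrite (cardsD1 x) xA leq_add2l -(card_imset _ pair_inj).
apply/subset_leq_card/subsetP => p /imsetP[y]; rewrite !inE => /andP[yx yA] -> /=.
rewrite xA yA /rank_lt /= ltn_neqAle x_min // andbT.
by rewrite (inj_eq val_inj) (inj_eq enum_rank_inj) eq_sym.
Qed.

(* The second Bonferroni inequality, with the union bounded by the whole of C. *)
Lemma sum_card_le_pairs (C : finType) (f : T -> {set C}) :
  (\sum_v #|f v| <= #|C| + \sum_(p | rank_lt p) #|f p.1 :&: f p.2|)%N.
Proof.
have cardE (A : {set C}) : #|A| = (\sum_c (c \in A))%N.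
  by rewrite -sum1_card big_mkcond; apply: eq_bigr => c _; case: (c \in A).
rewrite (eq_bigr _ (fun v _ => cardE (f v))) exchange_big /=.
rewrite (eq_bigr _ (fun p _ => cardE (f p.1 :&: f p.2))) [X in (_ + X)%N]exchange_big /=.
rewrite -sum1_card -big_split /=; apply: leq_sum => c _.
apply: leq_trans (leq_trans (card_le_pairs [set v | c \in f v]) _).
  rewrite -sum1_card [leqRHS]big_mkcond; apply: leq_sum => v _.
  by rewrite inE; case: (c \in f v).
rewrite leq_add2l -sum1_card big_mkcond [leqRHS]big_mkcond /=.
apply: leq_sum => p _; rewrite !inE.
by case: (c \in f p.1); case: (c \in f p.2); case: rank_lt.
Qed.

(** With [w p] the size of the color block indexed by [p], this will give [#|f v|] in the
    construction: private colors sit in the diagonal block [(v, v)], shared ones in the others. *)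
Lemma sum_incident (w : T * T -> nat) v :
  (\sum_(p | (v == p.1) || (v == p.2)) w p
   = w (v, v) + \sum_(u | u != v) (w (u, v) + w (v, u)))%N.
Proof.
rewrite (eq_bigr (fun p => w (p.1, p.2))) => [|[] //].
rewrite -(pair_big_dep xpredT (fun a b => (v == a) || (v == b)) (fun a b => w (a, b))) /=.
rewrite (bigD1 v) //= eqxx (bigD1 v) //= big_split /= -addnA; congr addn.
rewrite [RHS]addnC; congr addn; apply: eq_bigr => u uv.
by rewrite eq_sym (negbTE uv) /= (big_pred1 v) // => x; rewrite /= eq_sym.
Qed.

(** Likewise for [#|f u :&: f v|]: an index having both [u] and [v] as coordinates is one of their
    two orderings. *)
Lemma sum_incident2 (w : T * T -> nat) u v : u != v ->
  (\sum_(p | ((u == p.1) || (u == p.2)) && ((v == p.1) || (v == p.2))) w p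
   = w (u, v) + w (v, u))%N.
Proof.
move=> uv; rewrite (bigD1 (u, v)) /= ?eqxx ?orbT //; congr addn.
apply: big_pred1 => -[a b] /=; rewrite !xpair_eqE !(eq_sym u) !(eq_sym v).
by case: (eqVneq a u) => [->|_]; case: (eqVneq b u) => [->|_];
  rewrite ?(negbTE uv) /= ?orbF ?andbT ?andbF ?andbN.
Qed.

(** Double counting: every unordered pair is met once from each of its endpoints. *)
Lemma sum_neq_pairs (d : T -> T -> nat) : (forall u v, d u v = d v u) ->
  (\sum_v \sum_(u | u != v) d u v = (\sum_(p | rank_lt p) d p.1 p.2).*2)%N.
Proof.
move=> d_sym; rewrite pair_big_dep /= (bigID rank_lt) /= -addnn; congr addn.
  apply: eq_big => [[u v]|p _] /=; last by rewrite d_sym.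
  by case: (boolP (rank_lt (u, v))) => [/rank_lt_neq /=|]; rewrite ?andbF // eq_sym => ->.
rewrite (reindex_inj (can_inj (@swap_pairK T T))) /=; apply: eq_big => // -[u v] /=.
have [->|uv] := eqVneq u v; first by rewrite /rank_lt ltnn.
by rewrite /swap_pair /= (rank_ltN uv) negbK.
Qed.

End Pairs.

Lemma card_tag_set (I : finType) (w : I -> nat) (P : pred I) :
  #|[set x : {i : I & 'I_(w i)} | P (tag x)]| = (\sum_(i | P i) w i)%N.
Proof.
rewrite -sum1_card; under eq_bigl do rewrite inE.
under [RHS]eq_bigr do rewrite -[w _]card_ord -sum1_card.
by rewrite sig_big_dep /=; apply: eq_bigl => x; rewrite andbT.
Qed.

(** Relabeling by [enum_rank] preserves the sizes of sets and intersections, so a coloring may be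
    built over any convenient color type. *)
Lemma tone_colorable_card (T : finType) (e : rel T) (t : nat) (C : finType)
    (f : {ffun T -> {set C}}) :
  tone_coloring e t f -> tone_colorable e t #|C|.
Proof.
case/andP=> /forallP card_f /forallP disj_f; apply/existsP.
exists [ffun v => [set enum_rank x | x in f v]]; apply/andP; split.
  by apply/forallP => v; rewrite ffunE card_imset //; apply: enum_rank_inj.
apply/forallP => u; apply/forallP => v; move/forallP/(_ v): (disj_f u).
rewrite !ffunE -imsetI ?card_imset //; first exact: enum_rank_inj.
by move=> x y _ _; apply: enum_rank_inj.
Qed.

Lemma tone_colorable_ge (T : finType) (e : rel T) (t k : nat) :
  tone_colorable e t k ->
  (t * #|T| <= k + \sum_(p : T * T | rank_lt p) (dist e p.1 p.2).-1)%N.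
Proof.
case/existsP=> f /andP[/forallP card_f /forallP disj_f].
have := sum_card_le_pairs f; rewrite card_ord.
rewrite (eq_bigr _ (fun v _ => eqP (card_f v))) sum_nat_const mulnC.
move/leq_trans; apply; rewrite leq_add2l; apply: leq_sum => p /rank_lt_neq uv.
by move/forallP/(_ p.2): (disj_f p.1); rewrite uv; case: (dist e _ _).
Qed.

(** If [s v] is the inner sum and [P] the sum over pairs, the construction uses [P] plus all the
    [t - s v] colors; since the [s v] add up to [2P], this is [t * #|T| - P]. *)
Lemma tone_colorable_eq (T : finType) (e : rel T) (t : nat) :
  symmetric e ->
  (forall v, \sum_(u | u != v) (dist e u v).-1 <= t)%N ->
  exists2 k, tone_colorable e t k
    & (k + \sum_(p : T * T | rank_lt p) (dist e p.1 p.2).-1 = t * #|T|)%N.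
Proof.
move=> e_sym le_t; pose s v := (\sum_(u | u != v) (dist e u v).-1)%N.
(* Only one order of each pair gets a block, so shared colors are not created twice; [le_t] makes
   the truncated [t - s v] exact. *)
pose w (p : T * T) := (if p.1 == p.2 then t - s p.1
  else if rank_lt p then (dist e p.1 p.2).-1 else 0)%N.
have w_pair u v : u != v -> (w (u, v) + w (v, u) = (dist e u v).-1)%N.
  move=> uv; rewrite /w /= (eq_sym v) (negbTE uv) (rank_ltN uv) (dist_sym v u e_sym).
  by case: rank_lt; rewrite ?addn0.
pose C : finType := {p : T * T & 'I_(w p)}.
have cardC (P : pred (T * T)) : #|[set x : C | P (tag x)]| = (\sum_(p | P p) w p)%N.
  exact: card_tag_set.
pose f := [ffun v => [set x : C | (v == (tag x).1) || (v == (tag x).2)]].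
exists #|C|.
  apply: (@tone_colorable_card _ _ _ _ f); apply/andP; split; apply/forallP => u.
    rewrite ffunE (cardC (fun p => (u == p.1) || (u == p.2))) sum_incident.
    by rewrite (eq_bigr _ (w_pair ^~ u)) {1}/w /= eqxx subnK //; apply: le_t.
  apply/forallP => v; apply/implyP => uv; rewrite !ffunE -setIdE.
  set A := finset _; have -> : A = [set x : C | ((u == (tag x).1) || (u == (tag x).2))
      && ((v == (tag x).1) || (v == (tag x).2))] by apply/setP => x; rewrite !inE.
  rewrite (cardC (fun p => ((u == p.1) || (u == p.2))
      && ((v == p.1) || (v == p.2)))) sum_incident2 // w_pair //.
  by rewrite prednK // dist_gt0.
have -> : #|C| = (\sum_p w p)%N.
  by rewrite -(cardC xpredT); apply: eq_card => x; rewrite !inE.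
rewrite (bigID (fun p => p.1 == p.2)) /=.
have -> : (\sum_(p : T * T | p.1 == p.2) w p = \sum_v (t - s v))%N.
  rewrite (eq_bigr (fun p => w (p.1, p.2))) => [|[] //].
  rewrite -(pair_big_dep xpredT (fun a b => a == b) (fun a b => w (a, b))) /=.
  apply: eq_bigr => v _; rewrite (big_pred1 v) => [|x]; last by rewrite /= eq_sym.
  by rewrite /w /= eqxx.
have -> : (\sum_(p : T * T | p.1 != p.2) w p
    = \sum_(p : T * T | rank_lt p) (dist e p.1 p.2).-1)%N.
  rewrite big_mkcond [RHS]big_mkcond; apply: eq_bigr => p _; rewrite /w.
  by case: (boolP (rank_lt p)) => [/rank_lt_neq|_]; case: eqP.
(* Trading [P + P] for the sum of the [s v] turns each vertex term into [(t - s v) + s v = t]. *)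
rewrite -addnA addnn -(@sum_neq_pairs _ (fun u v => (dist e u v).-1)); last first.
  by move=> u v; rewrite dist_sym.
rewrite -big_split /= (eq_bigr (fun=> t)) => [|v _]; last by rewrite subnK ?le_t.
by rewrite sum_nat_const mulnC.
Qed.

(** Distinct vertices have positive distance, so truncation in [.-1] never occurs. *)
Lemma sum_pairs_dist (T : finType) (e : rel T) :
  sum_pairs (fun u v => (dist e u v)%:Z - 1)
  = (\sum_(p : T * T | rank_lt p) (dist e p.1 p.2).-1)%N%:Z.
Proof.
rewrite /sum_pairs -natz natr_sum; apply: eq_bigr => p /rank_lt_neq/(dist_gt0 e).
by case: (dist e _ _) => // d _; rewrite natz -addn1 PoszD addrK addn1.
Qed.

Theorem theorem1p18 (T : finType) (e : rel T)
    (e_sym : symmetric e) (e_irr : irreflexive e)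
    (e_conn : connected_graph e) (t : nat) (t_ge1 : (1 <= t)%N) :
  (t%:Z * #|T|%:Z - sum_pairs (fun u v => (dist e u v)%:Z - 1)
     <= (tone_number e t)%:Z)
  /\ ((#|T|%:Z - 1) * ((diameter e)%:Z - 1) <= t%:Z ->
      (tone_number e t)%:Z
        = t%:Z * #|T|%:Z - sum_pairs (fun u v => (dist e u v)%:Z - 1)).
Proof.
rewrite sum_pairs_dist /tone_number; case: ex_minnP => k col_k min_k.
have k_ge := tone_colorable_ge col_k; split; first by lia.
move=> le_t; have [|k' col_k' k'E] := @tone_colorable_eq _ _ t e_sym.
  move=> v; apply: (@leq_trans (#|T|.-1 * (diameter e).-1)%N); last first.
    have : (0 < #|T|)%N by apply/card_gt0P; exists v.
    (* At diameter 0 the integer factor is -1 but [.-1] gives 0, so this case is separate. *)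
    case: (diameter e) le_t => [|D]; first by rewrite muln0.
    by case: #|T| => //= n; rewrite !intS ![1 + _]addrC !addrK -PoszM lez_nat.
  rewrite -(cardC1 v) -sum_nat_const; apply: leq_sum => u _.
  by rewrite -!subn1 leq_sub2r // dist_le_diameter.
(* Minimality gives [k <= k']; the lower bound [k_ge] gives the converse. *)
have := min_k _ col_k'; lia.
Qed.
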